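(* Let $\Pi$ be a joint distribution of $(v_1,v_2,y)\in[0,1]\times[0,1]\times\{0,1\}$. Let $J_1$ denote the distribution of $(v_1,y)$ and let $J_2$ denote the distribution of $(v_2,y)$. Then $$|\ell_1\text{-}\mathrm{ATB}(J_1)-\ell_1\text{-}\mathrm{ATB}(J_2)|\le3\,\mathbb E_\Pi|v_1-v_2|,$$ $$|\mathrm{ATB}(J_1)-\mathrm{ATB}(J_2)|\le6\,\mathbb E_\Pi|v_1-v_2|.$$
   Context: For a distribution $J$ of $(v,y)\in[0,1]\times\{0,1\}$, $$\mathrm{ATB}(J)=\mathbb E_{q\sim\mathrm{Unif}([0,1])}\Big[\big(\mathbb E_J[(v-y)\mathbb I[v<q]]\big)^2+\big(\mathbb E_J[(v-y)\mathbb I[v\ge q]]\big)^2\Big],$$ $$\ell_1\text{-}\mathrm{ATB}(J)=\mathbb E_{q\sim\mathrm{Unif}([0,1])}\Big[\big|\mathbb E_J[(v-y)\mathbb I[v<q]]\big|+\big|\mathbb E_J[(v-y)\mathbb I[v\ge q]]\big|\Big].$$ *)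

(* Defs.v *)
From HB Require Import structures.
From mathcomp Require Import all_boot all_order all_algebra.
From mathcomp Require Import all_classical all_reals all_analysis.

Set Implicit Arguments.
Unset Strict Implicit.
Unset Printing Implicit Defensive.

Import Order.TTheory GRing.Theory Num.Theory.
Import numFieldNormedType.Exports.

Local Open Scope classical_set_scope.
Local Open Scope ring_scope.

(** A label in {0,1} is a [bool] [y], read as the real number [y%:R].
    The range [0,1] of the predictions is not part of the types: a joint
    distribution is required to give mass 1 to [unit_predictions].
    Expectations are real-valued integrals [\int[P]_x f x]; every integrand
    below is bounded (almost surely, for such distributions) and measurable, so
    the default value 0 of a non-finite integral plays no role. *)

Section ATB.
Context {R : realType}.
Implicit Type J : probability (measurableTypeR R * bool)%type R.

(* [b%R%:R] is the indicator of the comparison [b], a boolean cast to 0 or 1. *)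
Definition residual_below J (q : R) : R :=
  \int[J]_z (((z.1 : R) - z.2%:R) * ((z.1 : R) < q)%R%:R).

Definition residual_above J (q : R) : R :=
  \int[J]_z (((z.1 : R) - z.2%:R) * (q <= (z.1 : R))%R%:R).

Definition ATB J : R :=
  \int[uniform_prob (@ltr01 R)]_q
    ((residual_below J q) ^+ 2 + (residual_above J q) ^+ 2).

Definition l1_ATB J : R :=
  \int[uniform_prob (@ltr01 R)]_q
    (`|residual_below J q| + `|residual_above J q|).

End ATB.

Section joint.
Context {R : realType}.

Definition unit_predictions :
    set (measurableTypeR R * measurableTypeR R * bool)%type :=
  (`[0, 1] `*` `[0, 1]) `*` [set: bool].

Definition first_prediction
    (w : (measurableTypeR R * measurableTypeR R * bool)%type) :
  (measurableTypeR R * bool)%type := (w.1.1, w.2).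

Definition second_prediction
    (w : (measurableTypeR R * measurableTypeR R * bool)%type) :
  (measurableTypeR R * bool)%type := (w.1.2, w.2).

Lemma measurable_first_prediction :
  measurable_fun [set: _] first_prediction.
Proof.
apply: measurable_fun_pair; last exact: measurable_snd.
exact: measurableT_comp.
Qed.

Lemma measurable_second_prediction :
  measurable_fun [set: _] second_prediction.
Proof.
apply: measurable_fun_pair; last exact: measurable_snd.
exact: measurableT_comp.
Qed.

HB.instance Definition _ := isMeasurableFun.Build _ _ _ _
  first_prediction measurable_first_prediction.
HB.instance Definition _ := isMeasurableFun.Build _ _ _ _
  second_prediction measurable_second_prediction.

End joint.

(* Main.v *)
(** For a threshold [q], the two residual differences between [v1] and [v2]
    (below and above [q]) add up to at most [|v1 - v2|] when [q] does not
    separate [v1] from [v2], and to at most [2] when it does.  A uniform [q]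
    separates them with probability at most [|v1 - v2|], so by Tonelli the
    expected total difference is at most [3 E|v1 - v2|].  Since expected
    residuals are at most [1] in absolute value, squaring costs a
    further factor [2]. *)
Require Import Defs.
From mathcomp Require Import all_boot all_order all_algebra.
From mathcomp Require Import all_classical all_reals all_analysis.
From mathcomp Require Import measurable_realfun lra.

Import Order.TTheory GRing.Theory Num.Theory.
Import numFieldNormedType.Exports.

Local Open Scope classical_set_scope.
Local Open Scope ring_scope.

(** * Integration against a probability carried by an event of mass one *)

Section full_event.
Context {d} {T : measurableType d} {R : realType}.
Context (P : probability T R) (D : set T).
Hypotheses (mD : measurable D) (PD : P D = 1%E).
Implicit Types f g : T -> R.

Let PDC : P (~` D) = 0%E.
Proof. by rewrite probability_setC// PD subee. Qed.

(** The complement of [D] is negligible, so integrability is decided on [D], where [f] is bounded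
    and the mass is finite. This is how predictions typed as arbitrary reals are handled:
    boundedness holds only on the unit interval. *)
Lemma integrable_bounded_on_full f (C : R) : measurable_fun setT f ->
  (forall x, D x -> `|f x| <= C) -> P.-integrable setT (EFin \o f).
Proof.
move=> mf fC; apply/(negligible_integrable (measurableC mD) measurableT) => //.
  exact/measurable_EFinP.
rewrite setTD setCK; apply: measurable_bounded_integrable => //.
- by rewrite [ltLHS]PD ltry.
- exact: measurable_funTS.
- exists C; split; first exact: num_real.
  by move=> M CM x Dx /=; rewrite (le_trans (fC x Dx))// ltW.
Qed.

Lemma Rintegral_full f : P.-integrable setT (EFin \o f) ->
  \int[P]_x f x = \int[P]_(x in D) f x.
Proof.
move=> If; rewrite /Rintegral (negligible_integral (measurableC mD))//.
by rewrite setTD setCK.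
Qed.

Lemma le_Rintegral_full f g :
  P.-integrable setT (EFin \o f) -> P.-integrable setT (EFin \o g) ->
  (forall x, D x -> f x <= g x) -> \int[P]_x f x <= \int[P]_x g x.
Proof.
move=> If Ig fg; rewrite !Rintegral_full//.
by apply: le_Rintegral => //; [apply: integrableS If|apply: integrableS Ig].
Qed.

Lemma normr_Rintegral_le f (C : R) : measurable_fun setT f ->
  (forall x, D x -> `|f x| <= C) -> `|\int[P]_x f x| <= C.
Proof.
move=> mf fC; have If := integrable_bounded_on_full _ _ mf fC.
apply: (le_trans (le_normr_Rintegral measurableT If)).
have -> : C = \int[P]_x (cst C x).
  by rewrite Rintegral_cst// [X in fine X]probability_setT mulr1.
apply: le_Rintegral_full => //; first exact: integrable_norm.
(* The constant function is bounded by the absolute value of [C], as no sign of [C] is assumed. *)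
by apply: (@integrable_bounded_on_full _ `|C|) => //.
Qed.

End full_event.

(** * Measurability of parametrised integrals and of indicators *)

(** Tonelli makes the integrals of the positive and negative parts measurable in the parameter;
    their difference, and then its [fine], stay measurable. It serves for residuals as functions of
    the threshold. *)
Lemma measurable_fun_Rintegral {d1 d2} {T1 : measurableType d1}
    {T2 : measurableType d2} {R : realType}
    (mu : {sigma_finite_measure set T2 -> \bar R}) (f : T1 * T2 -> R) :
  measurable_fun setT f ->
  measurable_fun setT (fun x => \int[mu]_y f (x, y)).
Proof.
move=> /measurable_EFinP mf; apply: measurableT_comp => //.
under eq_fun do rewrite integralE.
apply: emeasurable_funB.
  have := measurable_fun_fubini_tonelli_F (m2 := mu) ((EFin \o f)^\+)%E
    (measurable_funepos mf) (fun=> funepos_ge0 _ _).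
  by apply: eq_measurable_fun => x _; apply: eq_integral => y _;
    rewrite !funeposE.
have := measurable_fun_fubini_tonelli_F (m2 := mu) ((EFin \o f)^\-)%E
  (measurable_funeneg mf) (fun=> funeneg_ge0 _ _).
by apply: eq_measurable_fun => x _; apply: eq_integral => y _;
  rewrite !funenegE.
Qed.

Lemma measurable_bool_natr {d} {T : measurableType d} {R : realType}
    (b : T -> bool) : measurable_fun setT b ->
  measurable_fun setT (fun x => (b x)%:R : R).
Proof.
move=> mb; rewrite (_ : (fun x => _) = fun x => if b x then 1 else 0).
  exact: measurable_fun_if.
by apply/funext => x; case: (b x).
Qed.

(** * Residuals: measurability, size, and variation with the prediction *)

Section residuals.
Context {R : realType}.
Implicit Type J : probability (measurableTypeR R * bool)%type R.
Implicit Types (v q : R) (y : bool).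

Definition unit_labelled : set (measurableTypeR R * bool)%type :=
  `[0, 1] `*` [set: bool].

Lemma measurable_unit_labelled : measurable unit_labelled.
Proof. by apply: measurableX => //; exact: measurable_itv. Qed.

Lemma measurable_below {d} {T : measurableType d} (v q : T -> R)
    (y : T -> bool) :
  measurable_fun setT v -> measurable_fun setT q -> measurable_fun setT y ->
  measurable_fun setT (fun x => (v x - (y x)%:R) * (v x < q x)%R%:R).
Proof.
move=> mv mq my; apply: measurable_funM.
  by apply: measurable_funB => //; exact: measurable_bool_natr.
by apply: measurable_bool_natr; exact: measurable_fun_ltr.
Qed.

Lemma measurable_above {d} {T : measurableType d} (v q : T -> R)
    (y : T -> bool) :
  measurable_fun setT v -> measurable_fun setT q -> measurable_fun setT y ->
  measurable_fun setT (fun x => (v x - (y x)%:R) * (q x <= v x)%R%:R).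
Proof.
move=> mv mq my; apply: measurable_funM.
  by apply: measurable_funB => //; exact: measurable_bool_natr.
by apply: measurable_bool_natr; exact: measurable_fun_ler.
Qed.

Lemma measurable_residual_below J : measurable_fun setT (residual_below J).
Proof.
apply: (measurable_fun_Rintegral J (fun p => ((p.2.1 : R) - p.2.2%:R) *
  ((p.2.1 : R) < (p.1 : R))%R%:R)).
by apply: measurable_below => //; exact: measurableT_comp.
Qed.

Lemma measurable_residual_above J : measurable_fun setT (residual_above J).
Proof.
apply: (measurable_fun_Rintegral J (fun p => ((p.2.1 : R) - p.2.2%:R) *
  ((p.1 : R) <= (p.2.1 : R))%R%:R)).
by apply: measurable_above => //; exact: measurableT_comp.
Qed.

Lemma normr_residual_le1 v y (b : bool) :
  0 <= v <= 1 -> `|(v - y%:R) * b%:R| <= 1.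
Proof.
move=> /andP[v0 v1]; rewrite ler_norml; apply/andP.
by case: y b => -[] /=; split; lra.
Qed.

Lemma normr_residual_below_le1 J q : J unit_labelled = 1%E ->
  `|residual_below J q| <= 1.
Proof.
move=> J1; apply: (normr_Rintegral_le _ _ measurable_unit_labelled J1).
  exact: measurable_below.
by move=> [v y] [/=]; rewrite in_itv/= => v01 _; exact: normr_residual_le1.
Qed.

Lemma normr_residual_above_le1 J q : J unit_labelled = 1%E ->
  `|residual_above J q| <= 1.
Proof.
move=> J1; apply: (normr_Rintegral_le _ _ measurable_unit_labelled J1).
  exact: measurable_above.
by move=> [v y] [/=]; rewrite in_itv/= => v01 _; exact: normr_residual_le1.
Qed.

(** If [v1] and [v2] lie on the same side of [q], one summand vanishes and in the other the label
    cancels. If [q] separates them, each summand is a single residual, of size at most 1, whence the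
    2. *)
Lemma normr_residual_diff_le v1 v2 y q : 0 <= v1 <= 1 -> 0 <= v2 <= 1 ->
  `|(v1 - y%:R) * (v1 < q)%R%:R - (v2 - y%:R) * (v2 < q)%R%:R| +
  `|(v1 - y%:R) * (q <= v1)%R%:R - (v2 - y%:R) * (q <= v2)%R%:R| <=
  `|v1 - v2| + 2 * ((v1 < q)%R != (v2 < q)%R)%:R.
Proof.
move=> /andP[v10 v11] /andP[v20 v21].
have bound v : 0 <= v -> v <= 1 -> `|v - y%:R| <= 1.
  move=> v_ge0 v_le1; have := normr_residual_le1 v y true.
  by rewrite mulr1; apply; apply/andP.
have b1 := bound _ v10 v11; have b2 := bound _ v20 v21.
have n12 : 0 <= `|v1 - v2| by [].
(* With [q <= v] turned into the negation of [v < q], two booleans decide all four indicators. *)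
rewrite !(leNgt q); case: (v1 < q)%R; case: (v2 < q)%R => /=;
  rewrite !mulr1 !mulr0 ?subr0 ?sub0r ?normrN ?normr0 ?addr0 ?add0r;
  rewrite ?opprB ?addrA ?subrK; lra.
Qed.

(** The separating thresholds form a half-open interval between the two predictions; its uniform
    probability is the Lebesgue measure of its part in the unit interval, hence at most its
    length. *)
Lemma integral_uniform_crossing_le v1 v2 :
  (\int[uniform_prob (@ltr01 R)]_q (((v1 < q)%R != (v2 < q)%R)%:R)%:E
    <= `|v1 - v2|%:E)%E.
Proof.
wlog v12 : v1 v2 / v1 <= v2.
  move=> h; have [/h//|/ltW/h] := leP v1 v2.
  rewrite distrC; apply: le_trans; rewrite le_eqVlt; apply/orP; left; apply/eqP.
  by apply: eq_integral => q _; rewrite eq_sym.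
have crossE : (fun q => ((((v1 < q)%R != (v2 < q)%R)%:R : R))%:E) =
    (EFin \o \1_(`]v1, v2]%classic : set (measurableTypeR R))).
  apply/funext => q; rewrite /= indicE mem_setE in_itv/=; congr (_%:R)%:E.
  congr nat_of_bool; case: (ltP v1 q) => vq; case: (ltP v2 q) => qv //=.
  (* The only case left, [q <= v1] with [v2 < q], contradicts [v1 <= v2]. *)
  by have := lt_le_trans qv (le_trans vq v12); rewrite ltxx.
rewrite crossE integral_uniform//; last exact/measurable_EFinP.
rewrite subr0 invr1 mul1e.
apply: (@le_trans _ _ (\int[lebesgue_measure]_q
    (\1_(`]v1, v2]%classic : set (measurableTypeR R)) q)%:E)%E).
  by apply: ge0_subset_integral => //; exact/measurable_EFinP.
rewrite integral_indic//= setIT lebesgue_measure_itv/= lte_fin.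
by case: ifPn => // _; rewrite distrC ger0_norm ?subr_ge0.
Qed.

End residuals.

(** Boundedness by [C] makes [F1] and [F2] integrable, so that the difference of integrals is the
    integral of the difference. *)
Lemma le_norm_Rintegral_sub {d} {T : measurableType d} {R : realType}
    (P : probability T R) (F1 F2 g : T -> R) (C : R) :
  measurable_fun setT F1 -> measurable_fun setT F2 ->
  (forall x, `|F1 x| <= C) -> (forall x, `|F2 x| <= C) ->
  P.-integrable setT (EFin \o g) ->
  (forall x, `|F1 x - F2 x| <= g x) ->
  `|\int[P]_x F1 x - \int[P]_x F2 x| <= \int[P]_x g x.
Proof.
move=> mF1 mF2 F1C F2C Ig F12.
have I1 : P.-integrable setT (EFin \o F1).
  exact: (integrable_bounded_on_full _ _ measurableT (probability_setT P) _ C).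
have I2 : P.-integrable setT (EFin \o F2).
  exact: (integrable_bounded_on_full _ _ measurableT (probability_setT P) _ C).
rewrite -RintegralB//.
have I12 : P.-integrable setT (EFin \o (fun x => F1 x - F2 x)).
  exact: (integrableB measurableT I1 I2).
apply: (le_trans (le_normr_Rintegral measurableT I12)).
by apply: le_Rintegral => //; exact: (integrable_norm I12).
Qed.

(** * Comparison of the two marginals on their common probability space *)

Section coupling.
Context {R : realType}.
Context
  (Pi : probability (measurableTypeR R * measurableTypeR R * bool)%type R).
Hypothesis unit_Pi : Pi unit_predictions = 1%E.
Let J1 := distribution Pi first_prediction.
Let J2 := distribution Pi second_prediction.

Let U := uniform_prob (@ltr01 R).

Let munit : measurable (@unit_predictions R).
Proof.
by apply: measurableX => //; apply: measurableX; exact: measurable_itv.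
Qed.

Let mv1 : measurable_fun setT
  (fun w : measurableTypeR R * measurableTypeR R * bool => w.1.1 : R).
Proof. exact: measurableT_comp. Qed.

Let mv2 : measurable_fun setT
  (fun w : measurableTypeR R * measurableTypeR R * bool => w.1.2 : R).
Proof. exact: measurableT_comp. Qed.

Lemma first_prediction_unit w :
  unit_predictions w -> unit_labelled (@first_prediction R w).
Proof. by move: w => [[v1 v2] y] [[/= v1I _] _]; split. Qed.

Lemma second_prediction_unit w :
  unit_predictions w -> unit_labelled (@second_prediction R w).
Proof. by move: w => [[v1 v2] y] [[/= _ v2I] _]; split. Qed.

Lemma distribution_unit (X : {RV Pi >-> (measurableTypeR R * bool)%type}) :
  (forall w, unit_predictions w -> unit_labelled (X w)) ->
  distribution Pi X unit_labelled = 1%E.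
Proof.
move=> XU; have mU := measurable_unit_labelled (R := R).
have mX : measurable (X @^-1` unit_labelled).
  by rewrite -[X in measurable X]setTI; exact: (measurable_funP X).
apply/eqP; rewrite eq_le (probability_le1 _ mU)/=.
apply: (@le_trans _ _ (Pi unit_predictions)); first by rewrite unit_Pi.
by apply: le_measure; rewrite ?inE.
Qed.

(** Change of variables: it pulls residuals of both marginals back to [Pi], where they can be
    subtracted pointwise. Integrability is returned too, since that subtraction requires it. *)
Lemma Rintegral_distribution_unit
    (X : {RV Pi >-> (measurableTypeR R * bool)%type})
    (f : measurableTypeR R * bool -> R) :
  (forall w, unit_predictions w -> unit_labelled (X w)) ->
  measurable_fun setT f -> (forall z, unit_labelled z -> `|f z| <= 1) ->
  Pi.-integrable setT (EFin \o (f \o X)) /\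
  \int[distribution Pi X]_z f z = \int[Pi]_w f (X w).
Proof.
move=> XU mf f1.
have If : Pi.-integrable setT (EFin \o (f \o X)).
  apply: (integrable_bounded_on_full _ _ munit unit_Pi _ 1).
    exact: measurableT_comp.
  by move=> w /XU/f1.
split => //; congr fine; rewrite integral_distribution//.
exact/measurable_EFinP.
Qed.

Let dist (w : measurableTypeR R * measurableTypeR R * bool) : R :=
  `|(w.1.1 : R) - w.1.2|.

Let cross (p : measurableTypeR R *
    (measurableTypeR R * measurableTypeR R * bool)) : R :=
  (((p.2.1.1 : R) < (p.1 : R))%R != ((p.2.1.2 : R) < (p.1 : R))%R)%:R.

Lemma measurable_cross : measurable_fun setT cross.
Proof.
apply: measurable_bool_natr.
have mlt (v : measurableTypeR R * measurableTypeR R * bool -> R) :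
    measurable_fun setT v -> measurable_fun setT
    (fun p : measurableTypeR R *
      (measurableTypeR R * measurableTypeR R * bool) =>
      (v p.2 < (p.1 : R))%R).
  by move=> mv; apply: measurable_fun_ltr => //; exact: measurableT_comp.
have m1 := mlt _ mv1; have m2 := mlt _ mv2.
(* Exclusive or as a conditional, so that measurability follows from that of the two comparisons. *)
rewrite (_ : (fun p => _) = (fun p => if ((p.2.1.1 : R) < (p.1 : R))%R
  then ~~ ((p.2.1.2 : R) < (p.1 : R))%R else ((p.2.1.2 : R) < (p.1 : R))%R)).
  by apply: measurable_fun_ifT => //; exact: measurable_neg.
by apply/funext => p; case: (_ < _)%R; case: (_ < _)%R.
Qed.

Let crossing q := \int[Pi]_w cross (q, w).

Lemma integrable_dist : Pi.-integrable setT (EFin \o dist).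
Proof.
apply: (integrable_bounded_on_full _ _ munit unit_Pi _ 1).
  by apply: measurableT_comp => //; exact: measurable_funB.
move=> [[v1 v2] y] [[/=]]; rewrite !in_itv/= => /andP[? ?] /andP[? ?] _.
rewrite /dist normr_id ler_norml/=; apply/andP; split; lra.
Qed.

Lemma integrable_cross q :
  Pi.-integrable setT (EFin \o (fun w => cross (q, w))).
Proof.
apply: (integrable_bounded_on_full _ _ munit unit_Pi _ 1).
  exact: measurableT_comp measurable_cross (measurable_pair1 q).
by move=> w _; rewrite /cross; case: (_ != _); rewrite ?normr1 ?normr0.
Qed.

Lemma measurable_crossing : measurable_fun setT crossing.
Proof. exact: measurable_fun_Rintegral measurable_cross. Qed.

Lemma integrable_crossing : U.-integrable setT (EFin \o crossing).
Proof.
apply: (integrable_bounded_on_full _ _ measurableT (probability_setT U) _ 1).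
  exact: measurable_crossing.
move=> q _; apply: (normr_Rintegral_le _ _ munit unit_Pi).
  exact: measurableT_comp measurable_cross (measurable_pair1 q).
by move=> w _; rewrite /cross; case: (_ != _); rewrite ?normr1 ?normr0.
Qed.

(** Tonelli exchanges the threshold and the sample; for a fixed sample the inner integral is then
    the uniform probability of separating its two predictions. *)
Lemma Rintegral_crossing_le :
  \int[U]_q crossing q <= \int[Pi]_w dist w.
Proof.
(* Real integrals are [fine] of extended ones, so finiteness of the outer integrals, then of the
   inner one, is settled before Tonelli applies. *)
rewrite -lee_fin /Rintegral !fineK ?integrable_fin_num//; last 2 first.
- exact: integrable_dist.
- exact: integrable_crossing.
under eq_integral do rewrite fineK ?integrable_fin_num ?integrable_cross//.
rewrite (fubini_tonelli (m1 := U) (m2 := Pi) (EFin \o cross))//; last 2 first.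
- by apply/measurable_EFinP; exact: measurable_cross.
- by move=> p; rewrite lee_fin.
apply: ge0_le_integral => //.
- by move=> w _; apply: integral_ge0 => q _; rewrite lee_fin.
- apply: (measurable_fun_fubini_tonelli_G (m1 := U) (EFin \o cross)).
    by apply/measurable_EFinP; exact: measurable_cross.
  by move=> p; rewrite lee_fin.
- apply/measurable_EFinP; apply: measurableT_comp => //.
  exact: measurable_funB.
- by move=> w _; exact: integral_uniform_crossing_le.
Qed.

Lemma residual_diff_le q :
  `|residual_below J1 q - residual_below J2 q| +
  `|residual_above J1 q - residual_above J2 q| <=
  \int[Pi]_w dist w + 2 * crossing q.
Proof.
pose below (z : measurableTypeR R * bool) : R :=
  ((z.1 : R) - z.2%:R) * ((z.1 : R) < q)%R%:R.
pose above (z : measurableTypeR R * bool) : R :=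
  ((z.1 : R) - z.2%:R) * (q <= (z.1 : R))%R%:R.
have mb : measurable_fun setT below by exact: measurable_below.
have ma : measurable_fun setT above by exact: measurable_above.
have bb z : unit_labelled z -> `|below z| <= 1.
  by move=> [/=]; rewrite in_itv/= => ? _; exact: normr_residual_le1.
have ba z : unit_labelled z -> `|above z| <= 1.
  by move=> [/=]; rewrite in_itv/= => ? _; exact: normr_residual_le1.
have [Ib1 Eb1] :=
  Rintegral_distribution_unit first_prediction _ first_prediction_unit mb bb.
have [Ib2 Eb2] :=
  Rintegral_distribution_unit second_prediction _ second_prediction_unit mb bb.
have [Ia1 Ea1] :=
  Rintegral_distribution_unit first_prediction _ first_prediction_unit ma ba.
have [Ia2 Ea2] :=
  Rintegral_distribution_unit second_prediction _ second_prediction_unit ma ba.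
rewrite /residual_below /residual_above -/below -/above Eb1 Eb2 Ea1 Ea2.
have Ib : Pi.-integrable setT
    (EFin \o (fun w =>
      below (first_prediction w) - below (second_prediction w))).
  exact: (integrableB measurableT Ib1 Ib2).
have Ia : Pi.-integrable setT
    (EFin \o (fun w =>
      above (first_prediction w) - above (second_prediction w))).
  exact: (integrableB measurableT Ia1 Ia2).
rewrite -!RintegralB//.
apply: (le_trans (lerD (le_normr_Rintegral measurableT Ib)
  (le_normr_Rintegral measurableT Ia))).
have Ic := integrable_cross q.
have I2c : Pi.-integrable setT (EFin \o (fun w => 2 * cross (q, w))).
  exact: (integrableZl measurableT 2 Ic).
rewrite -RintegralZl// -!RintegralD//; last 3 first.
- exact: (integrable_norm Ib).
- exact: (integrable_norm Ia).
- exact: integrable_dist.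
(* The pointwise bound is available only for predictions in the unit interval, an event of full
   mass. *)
apply: (le_Rintegral_full _ _ munit unit_Pi).
- exact: (integrableD measurableT (integrable_norm Ib) (integrable_norm Ia)).
- exact: (integrableD measurableT integrable_dist I2c).
move=> [[v1 v2] y] [[/=]]; rewrite !in_itv/= => v1I v2I _.
exact: normr_residual_diff_le.
Qed.

(** Common core of both bounds: [K] is a Lipschitz constant of the integrand in the pair of
    residuals, and [C] secures integrability. The 3 is 1 from the displacement of predictions plus 2
    from crossings. *)
Lemma Rintegral_coupling_le (F1 F2 : R -> R) (C K : R) : 0 <= K ->
  measurable_fun setT F1 -> measurable_fun setT F2 ->
  (forall q, `|F1 q| <= C) -> (forall q, `|F2 q| <= C) ->
  (forall q, `|F1 q - F2 q| <=
    K * (`|residual_below J1 q - residual_below J2 q| +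
         `|residual_above J1 q - residual_above J2 q|)) ->
  `|\int[U]_q F1 q - \int[U]_q F2 q| <= K * 3 * \int[Pi]_w dist w.
Proof.
move=> K0 mF1 mF2 F1C F2C F12; set E := \int[Pi]_w dist w.
have IE : U.-integrable setT (EFin \o (fun=> E)).
  exact: finite_measure_integrable_cst.
have Ic : U.-integrable setT (EFin \o (fun q => 2 * crossing q)).
  exact: (integrableZl measurableT 2 integrable_crossing).
have Ig : U.-integrable setT (EFin \o (fun q => E + 2 * crossing q)).
  exact: (integrableD measurableT IE Ic).
have IKg : U.-integrable setT (EFin \o (fun q => K * (E + 2 * crossing q))).
  exact: (integrableZl measurableT K Ig).
apply: (le_trans (le_norm_Rintegral_sub U _ _ _ _ mF1 mF2 F1C F2C IKg _)).
  by move=> q; rewrite (le_trans (F12 q))// ler_wpM2l// residual_diff_le.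
rewrite RintegralZl// -mulrA ler_wpM2l// RintegralD//.
rewrite Rintegral_cst// [X in fine X]probability_setT mulr1.
rewrite RintegralZl//; last exact: integrable_crossing.
have := Rintegral_crossing_le; rewrite -/E; lra.
Qed.

End coupling.

Theorem theorem4p9 (R : realType)
    (Pi : probability (measurableTypeR R * measurableTypeR R * bool)%type R)
    (unit_Pi : Pi unit_predictions = 1%E) :
  let J1 := distribution Pi first_prediction in
  let J2 := distribution Pi second_prediction in
  `|l1_ATB J1 - l1_ATB J2| <= 3 * \int[Pi]_w `|(w.1.1 : R) - w.1.2|
  /\ `|ATB J1 - ATB J2| <= 6 * \int[Pi]_w `|(w.1.1 : R) - w.1.2|.
Proof.
move=> J1 J2.
have J1u :=
  distribution_unit _ unit_Pi first_prediction (@first_prediction_unit R).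
have J2u :=
  distribution_unit _ unit_Pi second_prediction (@second_prediction_unit R).
have b1 q := normr_residual_below_le1 _ q J1u.
have a1 q := normr_residual_above_le1 _ q J1u.
have b2 q := normr_residual_below_le1 _ q J2u.
have a2 q := normr_residual_above_le1 _ q J2u.
have mb1 := measurable_residual_below J1.
have ma1 := measurable_residual_above J1.
have mb2 := measurable_residual_below J2.
have ma2 := measurable_residual_above J2.
split.
  (* [C] is 2 because two absolute values at most 1 are added; [K] is 1 by the reverse triangle
     inequality. *)
  rewrite -[3]mul1r; apply: (Rintegral_coupling_le _ unit_Pi _ _ 2 1) => //.
  - by apply: measurable_funD; exact: measurableT_comp.
  - by apply: measurable_funD; exact: measurableT_comp.
  - by move=> q; rewrite ger0_norm ?addr_ge0// lerD ?b1 ?a1.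
  - by move=> q; rewrite ger0_norm ?addr_ge0// lerD ?b2 ?a2.
  move=> q; rewrite mul1r opprD addrACA (le_trans (ler_normD _ _))//.
  by rewrite lerD// ler_dist_dist.
rewrite (_ : 6 = 2 * 3); last by rewrite -natrM.
have sq_le1 (a : R) : `|a| <= 1 -> a ^+ 2 <= 1.
  by move=> ha; rewrite -[_ ^+ 2]ger0_norm ?sqr_ge0// normrX exprn_ile1.
have sqB (a b : R) : `|a| <= 1 -> `|b| <= 1 ->
    `|a ^+ 2 - b ^+ 2| <= 2 * `|a - b|.
  (* Factor the difference of squares: the sum [a + b] has absolute value at most 2, which gives
     [K = 2] below. *)
  move=> ha hb; rewrite subr_sqr normrM mulrC ler_wpM2r//.
  by rewrite (le_trans (ler_normD _ _))// (le_trans (lerD ha hb)).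
apply: (Rintegral_coupling_le _ unit_Pi _ _ 2 2) => //.
- by apply: measurable_funD; exact: measurable_funX.
- by apply: measurable_funD; exact: measurable_funX.
- by move=> q; rewrite ger0_norm ?addr_ge0 ?sqr_ge0// lerD ?sq_le1 ?b1 ?a1.
- by move=> q; rewrite ger0_norm ?addr_ge0 ?sqr_ge0// lerD ?sq_le1 ?b2 ?a2.
move=> q; rewrite opprD addrACA (le_trans (ler_normD _ _))// mulrDr.
by rewrite lerD ?sqB ?b1 ?b2 ?a1 ?a2.
Qed.
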